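(* There is an absolute constant $C>0$ such that the following holds. Let $t\in\mathbb{N}$ be any positive integer, $\epsilon>0$ and $\beta\in(0,0.5)$. There is an $\epsilon$-DP algorithm which, given a weighted undirected graph $G=(V,E,\mathbf{w})$ on $n$ vertices, outputs values $\tilde d^{\le t}(u,v)$ for all $u,v\in V$ such that with probability $1-\beta$, $$\max_{u,v\in V}\left|\tilde d^{\le t}(u,v)-\mathrm{dist}^{\le t}_G(u,v)\right|\le C\cdot t\log(n/\beta)/\epsilon.$$
   Context: A weighted undirected graph is $G=(V,E,\mathbf{w})$ with $n=|V|$ vertices and real edge weights $\mathbf{w}\in\mathbb{R}^E$. A path is a $t$-hop path if it consists of at most $t$ edges; $\mathrm{dist}^{\le t}_G(u,v)$ denotes the smallest weight among all $t$-hop paths from $u$ to $v$. The underlying graph $(V,E)$ is fixed and public; the private input is $\mathbf{w}$, and two weight vectors $\mathbf{w},\mathbf{w}'$ on the same $(V,E)$ are neighbors if $\|\mathbf{w}-\mathbf{w}'\|_1\le 1$. A randomized algorithm $\mathcal{M}$ is $\epsilon$-DP if for all neighboring $\mathbf{w},\mathbf{w}'$ and every set $O$ of outputs, $\Pr[\mathcal{M}(\mathbf{w})\in O]\le e^{\epsilon}\Pr[\mathcal{M}(\mathbf{w}')\in O]$. *)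

(* Defs.v *)
From HB Require Import structures.
From mathcomp Require Import all_boot all_order all_algebra.
From mathcomp Require Import all_classical all_reals all_analysis.
From mathcomp Require Import measurable_realfun.

Set Implicit Arguments.
Unset Strict Implicit.
Unset Printing Implicit Defensive.

Import Order.TTheory GRing.Theory Num.Theory.
Import numFieldNormedType.Exports.

Local Open Scope ring_scope.

Record ugraph (V : finType) := UGraph {
  edges : {set {set V}};
  edges_card2 : forall e, e \in edges -> #|e| = 2%N
}.

Section Graph.
Context {V : finType}.
Implicit Types (G : ugraph V) (u v x y : V) (p : seq V).

Definition adj G : rel V := fun x y => [set x; y]%SET \in edges G.

Definition edge G : finType := {e : {set V} | e \in edges G}.

(* A path from u to v is u :: p, without repeated vertices; it has size p
   edges. *)
Definition hop_path G (t : nat) u v p : bool :=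
  [&& path (adj G) u p, last u p == v, uniq (u :: p) & (size p <= t)%N].

Context {R : realType}.

Definition weights G : Type := edge G -> R.

Definition neighbors G (w w' : weights G) : Prop :=
  \sum_(e : edge G) `|w e - w' e| <= 1.

(* The value 0 off the edges is never used along a path of G. *)
Definition edge_weight G (w : weights G) x y : R :=
  oapp w 0 (insub [set x; y]%SET : option (edge G)).

Definition path_weight G (w : weights G) u p : R :=
  \sum_(r <- pairmap (edge_weight w) u p) r.

(* The paths concerned are finitely many, so the infimum is a minimum, except
   that it is +oo when there is no such path. *)
Definition hop_dist G (w : weights G) (t : nat) u v : \bar R :=
  ereal_inf [set (path_weight w u p)%:E | p in [set p | hop_path G t u v p]]%classic.

End Graph.

Arguments weights {V} R G.

(* |x - y| on extended reals, with |oo - oo| = 0; in the library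
   +oo - +oo = -oo. *)
Definition abs_diff (R : realType) (x y : \bar R) : \bar R :=
  if x == y then 0%E else `|x - y|%E.

Definition cylinders (R : realType) (V : finType) : set (set (V -> V -> \bar R)) :=
  [set A | exists (u v : V) (B : set (\bar R)),
     measurable B /\ A = [set d : V -> V -> \bar R | B (d u v)]]%classic.

Arguments cylinders : clear implicits.

(* Output tables (u, v) |-> d u v, with the product sigma-algebra. *)
Definition table (R : realType) (V : finType) :=
  g_sigma_algebraType (cylinders R V).

Definition max_error (R : realType) (V : finType) (d d' : V -> V -> \bar R)
    : \bar R :=
  \big[maxe/0%E]_(uv : V * V) abs_diff (d uv.1 uv.2) (d' uv.1 uv.2).

(* A randomized algorithm is given by the law of its output on each input. *)
Definition mechanism (R : realType) : Type :=
  forall (V : finType) (G : ugraph V), weights R G -> probability (table R V) R.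

Definition dp (R : realType) (eps : R) (M : mechanism R) : Prop :=
  forall (V : finType) (G : ugraph V) (w w' : weights R G), neighbors w w' ->
  forall O : set (table R V), measurable O ->
    (M V G w O <= (expR eps)%:E * M V G w' O)%E.

(* Main.v *)
(** Add independent Laplace noise of rate [eps] to every edge weight and release
    the exact [t]-hop distances of the noisy graph.  Moving the weights by [a]
    translates the noise, and the density of the noise vector changes under
    translation by a factor of at most [exp (eps * |a|_1)]; this is privacy, and
    the distances are post-processing.  If no noise exceeds [s], then every
    [t]-hop path weight, hence every distance, moves by at most [t * s].  A
    single noise exceeds [s] with probability at most [exp (- eps * s)] and there
    are at most [n^2] edges, so [s = 2 ln (n / beta) / eps] makes the union bound
    [beta^2 <= beta]. *)
Require Import Defs.
From HB Require Import structures.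
From mathcomp Require Import all_boot all_order all_algebra.
From mathcomp Require Import all_classical all_reals all_analysis.
From mathcomp Require Import measurable_realfun ring lra.

Set Implicit Arguments.
Unset Strict Implicit.
Unset Printing Implicit Defensive.

Import Order.TTheory GRing.Theory Num.Theory.
Import numFieldNormedType.Exports.

Local Open Scope ring_scope.
Local Open Scope classical_set_scope.

(** * Translation invariance of Lebesgue measure and integral *)

Section lebesgue_translation.
Context {R : realType}.
Local Notation mu := (@lebesgue_measure R).

Lemma measurable_translation (a : R) :
  measurable_fun [set: R] (fun x : R => x + a).
Proof. exact: measurable_funD. Qed.

(** The push-forward of [mu] along the translation gives every half-open interval its length, and
    this characterizes Lebesgue measure. *)
Lemma lebesgue_measure_translation (a : R) (A : set R) : measurable A ->
  mu ((fun x => x + a) @^-1` A) = mu A.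
Proof.
move=> mA.
pose T : R -> measurableTypeR R := fun x => x + a.
have mT : measurable_fun [set: R] T by exact: measurable_translation.
apply/esym.
rewrite (@lebesgue_measure_unique R (pushforward mu T)) //= => _ [[b c] _ <-].
rewrite /pushforward (_ : T @^-1` _ = `](b - a), (c - a)]%classic).
  rewrite !lebesgue_measure_itv/= !lte_fin ltrD2r -!EFinB.
  by rewrite opprB addrA subrK.
by apply/seteqP; split => x /=; rewrite !in_itv/= /T ltrBlDr lerBrDr.
Qed.

Lemma ge0_integral_translation (a : R) (A : set R) (g : R -> \bar R) :
  measurable A -> measurable_fun [set: R] g -> (forall x, (0 <= g x)%E) ->
  (\int[mu]_(x in (fun x => x + a)%R @^-1` A) g (x + a)%R = \int[mu]_(x in A) g x)%E.
Proof.
move=> mA mg g0.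
pose T : R -> measurableTypeR R := fun x => x + a.
have mT : measurable_fun [set: R] T by exact: measurable_translation.
rewrite [RHS](@eq_measure_integral _ _ _ _ (pushforward mu T)).
  rewrite ge0_integral_pushforward//; exact: measurable_funS mg.
by move=> B mB _; rewrite -[LHS](lebesgue_measure_translation a).
Qed.

End lebesgue_translation.

(** * The Laplace distribution: total mass, shifts, tail *)

Section laplace.
Context {R : realType}.
Local Notation mu := (@lebesgue_measure R).
Variable rate : R.

Definition laplace_pdf (x : R) : R := rate / 2 * expR (- rate * `|x|).

Definition laplace_prob (A : set R) : \bar R :=
  (\int[mu]_(x in A) (laplace_pdf x)%:E)%E.

Lemma continuous_laplace_pdf : continuous laplace_pdf.
Proof.
move=> x; apply: (@continuousM _ R^o (fun=> rate / 2) (fun x => expR (- rate * `|x|))).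
  exact: cst_continuous.
apply: continuous_comp; last exact: continuous_expR.
apply: (@continuousM _ R^o (fun=> - rate) (fun x => `|x|)).
  exact: cst_continuous.
exact: norm_continuous.
Qed.

Lemma measurable_laplace_pdf :
  measurable_fun [set: R] (fun x => (laplace_pdf x)%:E).
Proof.
apply/measurable_EFinP; apply: continuous_measurable_fun.
exact: continuous_laplace_pdf.
Qed.

Hypothesis rate_gt0 : 0 < rate.

Lemma laplace_pdf_ge0 x : (0 <= (laplace_pdf x)%:E)%E.
Proof. by rewrite lee_fin mulr_ge0 ?expR_ge0// divr_ge0// ltW. Qed.

(** By symmetry the integral is twice that over the nonnegative half-line, where twice the density
    is the exponential density of the same rate. *)
Lemma integral_laplace_pdf : (\int[mu]_x (laplace_pdf x)%:E = 1)%E.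
Proof.
rewrite ge0_symfun_integralT; first last.
- by move=> x; rewrite /laplace_pdf /= normrN.
- exact: continuous_laplace_pdf.
- by move=> x; rewrite -lee_fin laplace_pdf_ge0.
rewrite -ge0_integralZl//; first last.
- by move=> x _; exact: laplace_pdf_ge0.
- by apply: measurable_funTS; exact: measurable_laplace_pdf.
- by rewrite -set_itvcy.
rewrite -[RHS](integral_exponential_pdf rate_gt0).
rewrite integral_mkcond; apply: eq_integral => x _.
rewrite /exponential_pdf !patchE set_itvcy; case: ifPn => //.
rewrite inE/= => x0; rewrite -EFinM /laplace_pdf ger0_norm//.
by congr EFin; field.
Qed.

Let laplace0 : laplace_prob set0 = 0%E.
Proof. by rewrite /laplace_prob integral_set0. Qed.

Let laplace_ge0 A : (0 <= laplace_prob A)%E.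
Proof. by apply: integral_ge0 => x _; exact: laplace_pdf_ge0. Qed.

Let laplace_sigma_additive : semi_sigma_additive laplace_prob.
Proof.
move=> /= F mF tF mUF; rewrite /laplace_prob; apply: cvg_toP.
  apply: ereal_nondecreasing_is_cvgn => m n mn.
  by apply: lee_sum_nneg_natr => // k _ _; exact: laplace_ge0.
rewrite ge0_integral_bigcup//=.
- by apply: measurable_funTS; exact: measurable_laplace_pdf.
- by move=> x _; exact: laplace_pdf_ge0.
Qed.

HB.instance Definition _ := isMeasure.Build _ _ _
  laplace_prob laplace0 laplace_ge0 laplace_sigma_additive.

Let laplace_setT : laplace_prob [set: R] = 1%E.
Proof. exact: integral_laplace_pdf. Qed.

HB.instance Definition _ :=
  @Measure_isProbability.Build _ _ R laplace_prob laplace_setT.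

Definition laplace : probability R R := laplace_prob.

(** This is the triangle inequality [|x| <= |x - a| + |a|] in the exponent. *)
Lemma laplace_pdf_translation (a x : R) :
  laplace_pdf (x - a) <= expR (rate * `|a|) * laplace_pdf x.
Proof.
rewrite /laplace_pdf mulrCA ler_pM2l ?divr_gt0// -expRD ler_expR.
have := ler_normD (x - a) a; rewrite subrK -(ler_pM2l rate_gt0) mulrDr.
by rewrite !mulNr; lra.
Qed.

(** One-dimensional privacy bound: a change of variable moves the shift from the set to the density,
    where the pointwise bound applies. *)
Lemma laplace_translation_le (a : R) (A : set R) : measurable A ->
  (laplace_prob ((fun x => x + a)%R @^-1` A) <=
   (expR (rate * `|a|))%:E * laplace_prob A)%E.
Proof.
move=> mA; rewrite /laplace_prob.
under eq_integral do rewrite -[X in laplace_pdf X](addrK a).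
rewrite (ge0_integral_translation a
  (g := fun x => (laplace_pdf (x - a))%:E))//; last first.
- by move=> x; exact: laplace_pdf_ge0.
- apply: (measurableT_comp measurable_laplace_pdf).
  exact: measurable_translation.
rewrite -ge0_integralZl//; first last.
- by move=> x _; exact: laplace_pdf_ge0.
- by apply: measurable_funTS; exact: measurable_laplace_pdf.
apply: ge0_le_integral => //.
- by move=> x _; exact: laplace_pdf_ge0.
- apply: measurable_funTS; apply: (measurableT_comp measurable_laplace_pdf).
  exact: measurable_translation.
- apply: measurable_funTS; apply: measurable_funeM.
  exact: measurable_laplace_pdf.
- by move=> x _; rewrite -EFinM lee_fin laplace_pdf_translation.
Qed.

(** When [a] and [x] do not have opposite signs, the triangle inequality is an equality:
    [|x + a| = |x| + |a|]. *)
Lemma laplace_pdf_scale (a x : R) : 0 <= a * x ->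
  laplace_pdf (x + a) = expR (- rate * `|a|) * laplace_pdf x.
Proof.
move=> ax; rewrite /laplace_pdf mulrCA -expRD -mulrDr.
congr (_ * expR (_ * _)); rewrite addrC.
have [a0|a0] := leP 0 a; have [x0|x0] := leP 0 x.
- by rewrite !ger0_norm// addr_ge0.
- have [->|an0] := eqVneq a 0; first by rewrite normr0 !add0r.
  by move: ax; rewrite leNgt pmulr_rlt0 ?x0// lt0r an0.
- have [->|xn0] := eqVneq x 0; first by rewrite normr0 !addr0.
  by move: ax; rewrite leNgt nmulr_rlt0 ?(lt0r x) ?xn0 ?x0.
- by rewrite !ltr0_norm ?opprD// -[X in _ < X]addr0 ltrD.
Qed.

(** Memorylessness: moving a set away from the origin, on its own side, multiplies all density
    values by the same factor. This gives tail bounds without computing an integral. *)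
Lemma laplace_scale (a : R) (A : set R) : measurable A ->
  (forall x, A x -> 0 <= a * x) ->
  laplace_prob ((fun x => x - a)%R @^-1` A) =
  ((expR (- rate * `|a|))%:E * laplace_prob A)%E.
Proof.
move=> mA aA; rewrite /laplace_prob.
under eq_integral do rewrite -[X in laplace_pdf X](subrK a).
rewrite (ge0_integral_translation (- a)
  (g := fun x => (laplace_pdf (x + a))%:E))//; last first.
- by move=> x; exact: laplace_pdf_ge0.
- apply: (measurableT_comp measurable_laplace_pdf).
  exact: measurable_translation.
rewrite -ge0_integralZl//; first last.
- by move=> x _; exact: laplace_pdf_ge0.
- by apply: measurable_funTS; exact: measurable_laplace_pdf.
apply: eq_integral => x; rewrite inE => Ax.
by rewrite laplace_pdf_scale ?EFinM// aA.
Qed.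

(** The two tails are the open half-lines on either side of 0, each moved outwards by [s]. Each mass
    is scaled by [expR (- rate * s)], and the half-lines, being disjoint, have total mass at most
    1. *)
Lemma laplace_tail (s : R) : 0 <= s ->
  (laplace_prob [set x | s < `|x|]%R <= (expR (- rate * s))%:E)%E.
Proof.
move=> s0.
have -> : [set x | s < `|x|]%R =
    (fun x => x - s) @^-1` `]0%R, +oo[ `|` (fun x => x - - s) @^-1` `]-oo, 0%R[.
  apply/seteqP; split => x /=; rewrite !in_itv/= !andbT opprK subr_gt0.
    by rewrite ltr_normr => /orP[->|]; [left|right]; lra.
  by rewrite ltr_normr => -[->//|h]; apply/orP; right; lra.
have mtr (a : R) B : measurable B -> measurable ((fun x => x + a) @^-1` B).
  by move=> mB; rewrite -[X in measurable X]setTI; exact: measurable_translation.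
rewrite (le_trans (measureU2 _ _ _))//=; [exact: mtr|exact: mtr|].
rewrite !laplace_scale//; last 2 first.
- move=> x /=; rewrite in_itv/= => x0.
  by rewrite mulNr -mulrN mulr_ge0// oppr_ge0 ltW.
- by move=> x /=; rewrite in_itv/= andbT => x0; rewrite mulr_ge0// ltW.
rewrite normrN ger0_norm// -ge0_muleDr//.
rewrite -[leRHS]mule1 lee_wpmul2l ?lee_fin ?expR_ge0//.
rewrite -measureU//=; last first.
  by apply/seteqP; split => x //=; rewrite !in_itv/= andbT => -[h1 h2]; lra.
by apply: (@probability_le1 _ _ _ laplace); exact: measurableU.
Qed.

End laplace.

(** * Push-forwards, and domination under a map acting on one factor of a product *)

Definition image_prob (d d' : measure_display) (T : measurableType d)
    (T' : measurableType d') (R : realType) (P : probability T R)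
    (f : T -> T') (mf : measurable_fun [set: T] f) : probability T' R :=
  distribution P (HB.pack_for {mfun T >-> T'} f
                    (isMeasurableFun.Build _ _ _ _ f mf)).

Section product_domination.
Local Open Scope ereal_scope.
Context (d1 d2 : measure_display) (T1 : measurableType d1)
  (T2 : measurableType d2) (R : realType).
Variables (P1 : probability T1 R) (P2 : probability T2 R).

(** For each fixed second coordinate, the section of the preimage is the preimage under [h] of the
    section. The hypothesis therefore applies section by section and is then integrated. *)
Lemma product_preimage1_le (h : T1 -> T1) (k : R) :
  measurable_fun [set: T1] h -> (0 <= k)%R ->
  (forall A, measurable A -> P1 (h @^-1` A) <= k%:E * P1 A) ->
  forall B, measurable B ->
    (P1 \x P2) ((fun z => (h z.1, z.2)) @^-1` B) <= k%:E * (P1 \x P2) B.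
Proof.
move=> mh k0 hk B mB.
have mB' : measurable ((fun z : T1 * T2 => (h z.1, z.2)) @^-1` B).
  rewrite -[X in measurable X]setTI; apply: measurable_fun_pair => //.
  exact: measurableT_comp.
(* [\x] integrates the [P2]-measure of sections over the first coordinate. The bound concerns [P1],
   so the order of integration is exchanged by uniqueness of the product measure. *)
have E (X : set (T1 * T2)) : measurable X -> (P1 \x P2) X = (P1 \x^ P2) X.
  move=> mX; apply: product_measure_unique => // A C mA mC.
  exact: product_measure2E.
rewrite !E// /product_measure2 -ge0_integralZl//=; last first.
  exact: measurable_fun_ysection.
apply: ge0_le_integral => //=.
- exact: measurable_fun_ysection.
- by apply: measurable_funeM; exact: measurable_fun_ysection.
- move=> y _; rewrite (_ : ysection _ _ = h @^-1` (ysection B y)).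
    exact/hk/measurable_ysection.
  by apply/seteqP; split => x; rewrite /= /ysection/= !inE.
Qed.

Lemma product_preimage2_le (h : T2 -> T2) (k : R) :
  measurable_fun [set: T2] h -> (0 <= k)%R ->
  (forall A, measurable A -> P2 (h @^-1` A) <= k%:E * P2 A) ->
  forall B, measurable B ->
    (P1 \x P2) ((fun z => (z.1, h z.2)) @^-1` B) <= k%:E * (P1 \x P2) B.
Proof.
move=> mh k0 hk B mB.
have mB' : measurable ((fun z : T1 * T2 => (z.1, h z.2)) @^-1` B).
  rewrite -[X in measurable X]setTI; apply: measurable_fun_pair => //.
  exact: measurableT_comp.
rewrite /product_measure1 -ge0_integralZl//=; last first.
  exact: measurable_fun_xsection.
apply: ge0_le_integral => //=.
- exact: measurable_fun_xsection.
- by apply: measurable_funeM; exact: measurable_fun_xsection.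
- move=> x _; rewrite (_ : xsection _ _ = h @^-1` (xsection B x)).
    exact/hk/measurable_xsection.
  by apply/seteqP; split => y; rewrite /= /xsection/= !inE.
Qed.

End product_domination.

(** * Vectors of independent Laplace variables *)

Section laplace_vector.
Context {R : realType}.
Variable rate : R.
Hypothesis rate_gt0 : 0 < rate.

Definition cons_pair (n : nat) (z : R * n.-tuple R) : n.+1.-tuple R :=
  [tuple of z.1 :: z.2].

Lemma measurable_cons_pair (n : nat) :
  measurable_fun [set: R * n.-tuple R] (@cons_pair n).
Proof. exact: measurable_cons. Qed.

(** Independence is encoded by iterated binary products, so that facts about vectors follow by
    induction from the one-dimensional case and the two product lemmas. *)
Fixpoint laplace_vector (n : nat) : probability (n.-tuple R) R :=
  if n is m.+1 then
    image_prob ((laplace rate_gt0 \x laplace_vector m)%E : probability _ R)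
      (@measurable_cons_pair m)
  else dirac [tuple].

Definition translate (n : nat) (a : 'I_n -> R) (z : n.-tuple R) : n.-tuple R :=
  [tuple tnth z i + a i | i < n].

Lemma measurable_translate (n : nat) (a : 'I_n -> R) :
  measurable_fun [set: n.-tuple R] (translate a).
Proof.
apply/measurable_fun_tnthP => i.
rewrite (_ : _ \o _ = fun z : n.-tuple R => tnth z i + a i); last first.
  by apply/funext => z /=; rewrite tnth_mktuple.
by apply: measurable_funD => //; exact: measurable_tnth.
Qed.

(** The head and the tail are translated one after the other. The head costs
    [expR (rate * |a ord0|)], the tail is bounded by induction, and the factors multiply to the
    exponential of the l1 norm. *)
Lemma laplace_vector_translate_le (n : nat) (a : 'I_n -> R)
    (A : set (n.-tuple R)) : measurable A ->
  (laplace_vector n (translate a @^-1` A) <=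
   (expR (rate * \sum_i `|a i|))%:E * laplace_vector n A)%E.
Proof.
elim: n a A => [|n IH] a A mA.
  rewrite big_ord0 mulr0 expR0 mul1e (_ : translate a @^-1` A = A)//.
  by apply/funext => z /=; rewrite [translate a z]tuple0 [z]tuple0.
pose b i := a (lift ord0 i).
pose B := @cons_pair n @^-1` A.
have mB : measurable B.
  by rewrite -[X in measurable X]setTI; exact: measurable_cons_pair.
have mx : measurable_fun setT (fun x : R => x + a ord0).
  exact: measurable_translation.
(* [C] undoes only the translation of the tail; translating the head is the remaining half of the
   full translation. *)
pose C := (fun z : R * n.-tuple R => (z.1, translate b z.2)) @^-1` B.
have mC : measurable C.
  rewrite -[X in measurable X]setTI; apply: measurable_fun_pair => //.
  by apply: measurableT_comp => //; exact: measurable_translate.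
rewrite /= /distribution /pushforward /= -/B.
rewrite (_ : _ @^-1` _ = (fun z => (z.1 + a ord0, z.2)) @^-1` C); last first.
  suff E z : translate a (cons_pair z) =
      cons_pair (z.1 + a ord0, translate b z.2).
    by apply/seteqP; split => z /=; rewrite /C /B /= E.
  apply: eq_from_tnth => i; rewrite tnth_mktuple.
  by case: (unliftP ord0 i) => [j ->|->]; rewrite ?tnth0// !tnthS tnth_mktuple.
have := @product_preimage1_le _ _ _ _ _ (laplace rate_gt0) (laplace_vector n) _ _
  mx (expR_ge0 _) (fun X => @laplace_translation_le _ _ rate_gt0 _ X) _ mC.
move=> /le_trans; apply.
rewrite big_ord_recl mulrDr expRD EFinM -muleA.
apply: lee_wpmul2l; first by rewrite lee_fin expR_ge0.
have := @product_preimage2_le _ _ _ _ _ (laplace rate_gt0) (laplace_vector n) _ _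
  (measurable_translate b) (expR_ge0 _) (IH b) _ mB.
exact.
Qed.

Definition large_coord (n : nat) (s : R) : set (n.-tuple R) :=
  [set z | exists i, s < `|tnth z i|].

Lemma measurable_large_coord n s : measurable (@large_coord n s).
Proof.
rewrite (_ : @large_coord n s =
    \bigcup_(i in [set: 'I_n]) (@tnth n R ^~ i @^-1` [set x | s < `|x|])).
  apply: fin_bigcup_measurable => // i _.
  rewrite -[X in measurable X]setTI; apply: measurable_tnth => //.
  rewrite -[X in measurable X]setTI.
  by apply: measurable_fun_ltr => //; exact: measurableT_comp.
by apply/seteqP; split => z [i]; [exists i|move=> _; exists i].
Qed.

(** Union bound by induction: either the head is large or some coordinate of the tail is, and each
    event is a rectangle with one full side. *)
Lemma laplace_vector_tail n s : 0 <= s ->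
  (laplace_vector n (@large_coord n s) <= (n%:R * expR (- rate * s))%:E)%E.
Proof.
move=> s0; elim: n => [|n IH].
  rewrite mul0r (_ : large_coord _ = set0) ?measure0//.
  by apply/seteqP; split => // z [[]].
rewrite /= /distribution /pushforward /=.
pose S := [set x : R | s < `|x|].
have mS : measurable S.
  rewrite -[X in measurable X]setTI.
  by apply: measurable_fun_ltr => //; exact: measurableT_comp.
have mE := @measurable_large_coord n s.
rewrite (_ : _ @^-1` _ = S `*` setT `|` setT `*` (@large_coord n s)); last first.
  apply/seteqP; split => -[x z] /=.
    move=> [i]; case: (unliftP ord0 i) => [j ->|->];
      rewrite /cons_pair/= ?tnth0 ?tnthS => h.
      by right; split => //; exists j.
    by left; split.
  move=> [[h _]|[_ [i h]]]; first by exists ord0; rewrite tnth0.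
  by exists (lift ord0 i); rewrite tnthS.
rewrite (le_trans (measureU2 _ _ _))//; [exact: measurableX|exact: measurableX|].
rewrite -nat1r mulrDl mul1r EFinD; apply: leeD.
  have := @product_measure1E _ _ _ _ _ (laplace rate_gt0) (laplace_vector n)
    _ _ mS measurableT.
  rewrite [X in (_ * X)%E]probability_setT mule1 => E; rewrite [leLHS]E.
  exact: laplace_tail.
have := @product_measure1E _ _ _ _ _ (laplace rate_gt0) (laplace_vector n)
  _ _ measurableT mE.
by rewrite [X in (X * _)%E](probability_setT (laplace rate_gt0)) mul1e => E; rewrite [leLHS]E.
Qed.

End laplace_vector.

(** * Stability of hop distances under perturbation of the weights *)

Section hop_dist_stability.
Context {R : realType} {V : finType} (G : ugraph V).
Implicit Types (w : weights R G) (s c : R) (x y : \bar R).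

Lemma edge_weight_diff_le w w' s u v : 0 <= s ->
  (forall e, `|w e - w' e| <= s) ->
  `|edge_weight w u v - edge_weight w' u v| <= s.
Proof.
move=> s0 ws; rewrite /edge_weight; case: insub => [e|] /=; first exact: ws.
by rewrite subrr normr0.
Qed.

Lemma path_weight_cons w u v p :
  path_weight w u (v :: p) = edge_weight w u v + path_weight w v p.
Proof. by rewrite /path_weight /= big_cons. Qed.

Lemma path_weight_diff_le w w' s u p : 0 <= s ->
  (forall e, `|w e - w' e| <= s) ->
  `|path_weight w u p - path_weight w' u p| <= (size p)%:R * s.
Proof.
move=> s0 ws; elim: p u => [|v p IH] u.
  by rewrite /path_weight /= !big_nil subrr normr0 mul0r.
rewrite !path_weight_cons opprD addrACA (le_trans (ler_normD _ _))//.
by rewrite -nat1r mulrDl mul1r lerD// edge_weight_diff_le.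
Qed.

(** Each admissible path has at most [t] edges, so its weight changes by at most [t * s]; this
    passes to the infimum, also when there is no path and both sides are [+oo]. *)
Lemma hop_dist_le w w' t s u v : 0 <= s ->
  (forall e, `|w e - w' e| <= s) ->
  (hop_dist w t u v <= hop_dist w' t u v + (t%:R * s)%:E)%E.
Proof.
move=> s0 ws.
(* The finite constant is moved to the left so that the left side becomes a lower bound of all path
   weights for [w']. *)
have le_path p : hop_path G t u v p ->
    (hop_dist w t u v - (t%:R * s)%:E <= (path_weight w' u p)%:E)%E.
  move=> hp; rewrite leeBlDr//.
  apply: (@le_trans _ _ (path_weight w u p)%:E).
    by apply: ereal_inf_lbound; exists p.
  rewrite -EFinD lee_fin addrC -lerBlDr (le_trans (ler_norm _))//.
  rewrite (le_trans (path_weight_diff_le _ _ s0 ws))// ler_wpM2r// ler_nat.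
  by case/and4P: hp.
by rewrite -leeBlDr//; apply: le_ereal_inf_tmp => _ [p /= hp <-]; exact: le_path.
Qed.

(** If [x] and [y] differ and one of them is infinite, one of the two one-sided bounds fails; only
    the finite case needs an estimate. *)
Lemma abs_diff_le (x y : \bar R) c :
  (x <= y + c%:E)%E -> (y <= x + c%:E)%E -> (0 <= c) ->
  (abs_diff x y <= c%:E)%E.
Proof.
rewrite /abs_diff; case: eqVneq => [_ _ _ c0|+ + + _]; first by rewrite lee_fin.
case: x => [x| |]; case: y => [y| |] //= _; rewrite -?EFinD ?lee_fin.
by move=> xy yx; rewrite ler_norml; apply/andP; split; lra.
Qed.

Lemma max_error_leP (d d' : V -> V -> \bar R) c : 0 <= c ->
  (max_error d d' <= c%:E)%E <->
  forall u v, (abs_diff (d u v) (d' u v) <= c%:E)%E.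
Proof.
move=> c0; rewrite /max_error; split.
  by move=> /bigmax_leP[_ h] u v; exact: (h (u, v)).
by move=> h; apply/bigmax_leP; split => [|[u v] _]; rewrite ?lee_fin//; exact: h.
Qed.

Lemma hop_dist_max_error w w' t s : 0 <= s ->
  (forall e, `|w e - w' e| <= s) ->
  (max_error (hop_dist w t) (hop_dist w' t) <= (t%:R * s)%:E)%E.
Proof.
move=> s0 ws; apply/max_error_leP => [|u v]; first exact: mulr_ge0.
apply: abs_diff_le; [exact: hop_dist_le| |exact: mulr_ge0].
by apply: hop_dist_le => // e; rewrite distrC.
Qed.

End hop_dist_stability.

(** * Measurability in the space of output tables *)

Section table_measurability.
Context {R : realType} {V : finType}.

Lemma measurable_table_entry (u v : V) :
  measurable_fun [set: table R V] (fun d : table R V => d u v).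
Proof.
by move=> _ B mB; rewrite setTI; apply: sub_sigma_algebra; exists u, v, B.
Qed.

Lemma measurable_fun_table (d : measure_display) (T : measurableType d)
    (F : T -> table R V) :
  (forall u v, measurable_fun [set: T] (fun x => F x u v)) ->
  measurable_fun [set: T] F.
Proof.
move=> mF; apply: (@measurability _ _ _ (table R V) _ F (cylinders R V)) => //.
move=> _ [_ [u [v [B [mB ->]]]] <-]; exact: mF.
Qed.

Lemma measurable_abs_diff (y : \bar R) :
  measurable_fun [set: \bar R] (fun x => abs_diff x y).
Proof.
apply: measurable_fun_ifT => //.
- apply: (measurable_fun_bool true); rewrite setTI.
  rewrite (_ : _ @^-1` _ = [set y])//.
  by apply/seteqP; split => x /= /eqP.
- by apply: measurableT_comp => //; exact: emeasurable_funB.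
Qed.

(** By finiteness of [V], the event is a finite intersection of conditions on single entries. *)
Lemma measurable_max_error (d' : V -> V -> \bar R) (c : R) : 0 <= c ->
  measurable [set d : table R V | max_error d d' <= c%:E]%E.
Proof.
move=> c0.
rewrite (_ : [set d | _] = \bigcap_(uv in [set: V * V])
   [set d : table R V | abs_diff (d uv.1 uv.2) (d' uv.1 uv.2) <= c%:E]%E).
  apply: fin_bigcap_measurable => // -[u v] _ /=.
  rewrite -[X in measurable X]setTI.
  apply: emeasurable_fun_infty_c => //.
  apply: (measurableT_comp (measurable_abs_diff (d' u v))).
  exact: measurable_table_entry.
apply/seteqP; split => d /=.
  by move/(max_error_leP _ _ c0) => h uv _; exact: h.
by move=> h; apply/(max_error_leP _ _ c0) => u v; exact: (h (u, v)).
Qed.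

End table_measurability.

(** * The noisy distance table as a measurable function of the noise *)

Section noisy_hop_dist.
Context {R : realType} {V : finType} {G : ugraph V}.
Variable w : weights R G.

Definition add_noise (z : #|edge G|.-tuple R) : weights R G :=
  fun e => w e + tnth z (enum_rank e).

Lemma measurable_path_weight_add_noise u p :
  measurable_fun [set: #|edge G|.-tuple R]
    (fun z => path_weight (add_noise z) u p).
Proof.
elim: p u => [|v p IH] u.
  rewrite (_ : (fun _ => _) = cst 0)//.
  by apply/funext => z; rewrite /path_weight big_nil.
rewrite (_ : (fun _ => _) = fun z => edge_weight (add_noise z) u v +
                                    path_weight (add_noise z) v p); last first.
  by apply/funext => z; rewrite path_weight_cons.
apply: measurable_funD => //.
rewrite /edge_weight; case: insub => [e|] //=.
by apply: measurable_funD => //; exact: measurable_tnth.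
Qed.

(* The countable infimum ranges over all codes of vertex sequences; codes of
   non-paths contribute +oo. *)
Lemma measurable_hop_dist_add_noise t u v :
  measurable_fun [set: #|edge G|.-tuple R]
    (fun z => hop_dist (add_noise z) t u v).
Proof.
pose f (n : nat) (z : #|edge G|.-tuple R) : \bar R :=
  if (unpickle n : option (seq V)) is Some p then
    if hop_path G t u v p then (path_weight (add_noise z) u p)%:E else +oo%E
  else +oo%E.
rewrite (_ : (fun _ => _) = fun z => einfs (f ^~ z) 0).
  apply: measurable_fun_einfs => n; rewrite /f.
  case: unpickle => [p|] //; case: hop_path => //.
  by apply/measurable_EFinP; exact: measurable_path_weight_add_noise.
apply/funext => z; apply: le_anti; apply/andP; split.
  apply: le_ereal_inf_tmp => _ [n _ <-]; rewrite /f.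
  case: unpickle => [p|]; last exact: leey.
  case: ifP => hp; last exact: leey.
  by apply: ereal_inf_lbound; exists p.
apply: le_ereal_inf_tmp => _ [p /= hp <-].
by apply: ereal_inf_lbound; exists (pickle p) => //; rewrite /f pickleK hp.
Qed.

Definition noisy_table t (z : #|edge G|.-tuple R) : table R V :=
  hop_dist (add_noise z) t.

Lemma measurable_noisy_table t :
  measurable_fun [set: #|edge G|.-tuple R] (noisy_table t).
Proof.
by apply: measurable_fun_table => u v; exact: measurable_hop_dist_add_noise.
Qed.

End noisy_hop_dist.

(** * The mechanism, its privacy and its accuracy *)

(** Every edge is the unordered pair underlying some ordered pair of vertices. *)
Lemma card_edge_le (V : finType) (G : ugraph V) : (#|edge G| <= #|V| ^ 2)%N.
Proof.
rewrite card_sig.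
have -> : (#|V| ^ 2 = #|{: V * V}|)%N by rewrite card_prod mulnn.
apply: leq_trans (leq_imset_card (fun xy : V * V => [set xy.1; xy.2]%SET) predT).
apply: fintype.subset_leq_card; apply/fintype.subsetP => e.
move=> /edges_card2/eqP/cards2P[x [y [_ ->]]].
by apply/imsetP; exists (x, y).
Qed.

Definition laplace_mechanism (R : realType) (t : nat) (eps : R)
    (eps_gt0 : 0 < eps) : mechanism R :=
  fun V G w =>
    image_prob (laplace_vector eps_gt0 #|edge G|) (measurable_noisy_table w t).

(** Running on [w] amounts to running on [w'] with the noise translated by [w - w'], whose l1 norm
    is at most 1 for neighbors. *)
Lemma laplace_mechanism_dp (R : realType) t (eps : R) (eps_gt0 : 0 < eps) :
  dp eps (laplace_mechanism t eps_gt0).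
Proof.
move=> V G w w' ww' O mO.
rewrite /laplace_mechanism /= /distribution /pushforward /=.
pose a (i : 'I_#|edge G|) := w (enum_val i) - w' (enum_val i).
have noisyE : noisy_table w t = noisy_table w' t \o translate a.
  apply/funext => z; congr (hop_dist _ t); apply/funext => e.
  by rewrite /add_noise tnth_mktuple /a enum_rankK; ring.
rewrite noisyE comp_preimage.
rewrite (le_trans (laplace_vector_translate_le _ _ _))//.
  rewrite -[X in measurable X]setTI; exact: measurable_noisy_table.
apply: lee_wpmul2r => //; rewrite lee_fin ler_expR -[leRHS]mulr1 ler_pM2l//.
(* The sum over noise coordinates becomes the sum over edges in [neighbors]. *)
rewrite (reindex enum_rank) /=; last exact: onW_bij (@enum_rank_bij _).
by under eq_bigr do rewrite /a enum_rankK.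
Qed.

(** Off the event [large_coord], every edge weight moves by at most [s], so stability bounds the
    error; the tail bound controls that event. The threshold [s] stays free until the theorem. *)
Lemma laplace_mechanism_accuracy (R : realType) t (eps s : R)
    (eps_gt0 : 0 < eps) (V : finType) (G : ugraph V) (w : weights R G) :
  0 <= s ->
  ((1 - (#|edge G|%:R * expR (- eps * s)))%:E <=
   laplace_mechanism t eps_gt0 w [set d : table R V |
     max_error d (hop_dist w t) <= (t%:R * s)%:E]%E)%E.
Proof.
move=> s0; rewrite /laplace_mechanism /= /distribution /pushforward /=.
have mL := @measurable_large_coord R #|edge G| s.
apply: (@le_trans _ _
  (laplace_vector eps_gt0 #|edge G| (~` @large_coord R #|edge G| s))).
  by rewrite probability_setC// EFinB leeB// laplace_vector_tail.
apply: le_measure; rewrite ?inE; first exact: measurableC.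
  rewrite -[X in measurable X]setTI; apply: measurable_noisy_table => //.
  by apply: measurable_max_error; exact: mulr_ge0.
move=> z /= hz; apply: hop_dist_max_error => // e.
rewrite /add_noise addrC addKr leNgt; apply/negP => h.
by apply: hz; exists (enum_rank e).
Qed.

Theorem theorem3p1 (R : realType) :
  exists C : R, 0 < C /\
  forall (t : nat) (eps beta : R), (0 < t)%N -> 0 < eps -> 0 < beta < 2^-1 ->
  exists M : mechanism R, dp eps M /\
  forall (V : finType) (G : ugraph V) (w : weights R G),
    ((1 - beta)%:E <=
     M V G w [set d : table R V |
       (max_error d (hop_dist w t) <=
        (C * t%:R * ln (#|V|%:R / beta) / eps)%:E)%E]%classic)%E.
Proof.
(* The constant 2 matches the exponent in the bound [n^2] on the number of edges. *)
exists 2; split => // t eps beta _ eps0 /andP[b0 b2].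
exists (laplace_mechanism t eps0); split; first exact: laplace_mechanism_dp.
move=> V G w; pose s := 2 * ln (#|V|%:R / beta) / eps.
rewrite (_ : 2 * _ * _ / eps = t%:R * s); last by rewrite /s; ring.
(* With no vertices, [ln] takes its default value 0 at 0, so [s = 0]; there are no edges either, and
   the failure bound vanishes. *)
have [V0|V0] := posnP #|V|.
  have s0 : s = 0 by rewrite /s V0 mul0r ln0// mulr0 mul0r.
  apply: le_trans (laplace_mechanism_accuracy t eps0 w _); last by rewrite s0.
  have -> : #|edge G| = 0 by apply/eqP; have := card_edge_le G; rewrite V0 leqn0.
  by rewrite lee_fin mul0r lerB// ltW.
have n1 : 1 <= #|V|%:R :> R by rewrite ler1n.
have n0 : 0 < #|V|%:R / beta by rewrite divr_gt0// ltr0n.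
(* This makes the logarithm, hence [s], nonnegative. *)
have nb1 : 1 <= #|V|%:R / beta by rewrite ler_pdivlMr// mul1r; lra.
have s0 : 0 <= s by rewrite divr_ge0 ?(ltW eps0)// mulr_ge0// ln_ge0.
apply: le_trans (laplace_mechanism_accuracy t eps0 w s0).
(* Each edge fails with probability at most [(beta / n)^2]; over at most [n^2] edges this sums to
   [beta^2], which is below [beta] as [beta < 1]. *)
have -> : expR (- eps * s) = (beta / #|V|%:R) ^+ 2.
  rewrite (_ : - eps * s =
      - (ln (#|V|%:R / beta) + ln (#|V|%:R / beta))); last first.
    by rewrite /s; field; rewrite gt_eqF.
  by rewrite expRN expRD lnK ?posrE// -expr2 -exprVn invf_div.
rewrite lee_fin lerB//.
apply: (@le_trans _ _ (#|V|%:R ^+ 2 * (beta / #|V|%:R) ^+ 2)).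
  by rewrite ler_wpM2r ?sqr_ge0// -natrX ler_nat card_edge_le.
rewrite -exprMn mulrC divfK ?gt_eqF ?ltr0n// expr2 ger_pMl//; lra.
Qed.
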